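(* Let $m\geq 1$, $\mathbf{z}=(z_1,\ldots,z_m)\in\mathbb{N}^m$ and $\mathbf{n}=(n_1,\ldots,n_m)\in\mathbb{N}^m$, and let $p,q$ be integers with $p\geq \mathbf{n}\cdot\mathbf{z}$ and $q\geq 1$. Then there is a bijection between $\Gamma_{p+q+\mathbf{n}\cdot\mathbf{z},\mathbf{n}}^{(p)}$ and $\Gamma_{p+q+\mathbf{n}\cdot\mathbf{z},\mathbf{n}}^{(p+1)}$.
   Context: Let $\Gamma=\{a,b_1,\ldots,b_m\}$ be an alphabet with grading $\|a\|=1$ and $\|b_i\|=z_i+1$ for $1\le i\le m$, and let $\Gamma^*$ be the set of finite words over $\Gamma$. For a word $w=w_1\cdots w_n\in\Gamma^*$, its weight is $\|w\|=\|w_1\|+\cdots+\|w_n\|$, and $|w|_{b_i}$ is the number of occurrences of $b_i$ in $w$. For $\mathbf{n},\mathbf{z}\in\mathbb{N}^m$, $\mathbf{n}\cdot\mathbf{z}=n_1z_1+\cdots+n_mz_m$. For an integer $P$ and $\mathbf{k}=(k_1,\ldots,k_m)\in\mathbb{N}^m$, let $\Gamma_{P,\mathbf{k}}=\{w\in\Gamma^*: \|w\|=P \text{ and } |w|_{b_i}=k_i \text{ for } i=1,\ldots,m\}$, and for an integer $r$ let $\Gamma_{P,\mathbf{k}}^{(r)}=\{w\in\Gamma_{P,\mathbf{k}}: w \text{ has a prefix (initial segment } w_1\cdots w_j,\ 0\le j\le |w|) \text{ of weight } r\}$. *)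

(* Defs.v *)
From mathcomp Require Import all_boot all_order all_algebra.
Set Implicit Arguments.
Unset Strict Implicit.
Unset Printing Implicit Defensive.
Import Order.TTheory GRing.Theory Num.Theory.

(* The alphabet {a, b_1, ..., b_m}: [None] is a, [Some i] is b_(i+1). *)
Notation letter m := (option 'I_m).
Notation word m := (seq (letter m)).

Definition letter_b {m : nat} (i : 'I_m) : letter m := Some i.

Definition lweight {m : nat} (z : 'I_m -> nat) (x : letter m) : nat :=
  if x is Some i then z i + 1 else 1.

Definition weight {m : nat} (z : 'I_m -> nat) (w : word m) : nat :=
  \sum_(x <- w) lweight z x.

Definition dotn {m : nat} (n z : 'I_m -> nat) : nat := \sum_(i < m) n i * z i.

Definition Gamma {m : nat} (z : 'I_m -> nat) (P : int) (k : 'I_m -> nat) :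
    pred (word m) :=
  fun w => (Posz (weight z w) == P)
        && [forall i : 'I_m, count_mem (letter_b i) w == k i].

Definition Gamma_prefix {m : nat} (z : 'I_m -> nat) (P : int) (k : 'I_m -> nat)
    (r : int) : pred (word m) :=
  fun w => Gamma z P k w
        && [exists j : 'I_(size w).+1, Posz (weight z (take j w)) == r].

(* Main.v *)
Require Import Defs.
From mathcomp Require Import all_boot all_order all_algebra.
From mathcomp Require Import zify.
Import Order.TTheory GRing.Theory Num.Theory.
Local Open Scope ring_scope.

(** A word with a prefix of weight [r] is the same thing as a pair [(u, v)] with
    [u] of weight [r].  To move the cut from [r] to [r + 1], let [x] be the first
    letter of [v = x v']; write [e] for its weight minus 1.  Appending [x] to [u]
    overshoots by [e], so first move the cut of the shorter pair [(u, v')] to the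
    left [e] times, by recursion, and then insert [x] at the cut.  Moving left is
    the mirror image of moving right.  If [E] is the sum of the [e] over all
    letters, both moves are defined and mutually inverse as long as the cut keeps
    distance at least [E] from both ends of the word: removing [x] decreases [E]
    by exactly the [e] that the recursive moves consume. *)

Section Cut.
Local Open Scope nat_scope.
Variables (m : nat) (z : 'I_m -> nat).

(** * Weights and excesses *)

Definition excess (x : letter m) : nat := (lweight z x).-1.

Definition total_excess (w : word m) : nat := \sum_(x <- w) excess x.

Lemma lweightE x : lweight z x = (excess x).+1.
Proof. by case: x => [i|] //=; rewrite /excess /= addn1. Qed.

Lemma weight_cons x w : weight z (x :: w) = (excess x).+1 + weight z w.
Proof. by rewrite /weight big_cons lweightE. Qed.

Lemma weight_cat u v : weight z (u ++ v) = weight z u + weight z v.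
Proof. by rewrite /weight big_cat. Qed.

Lemma perm_weight u v : perm_eq u v -> weight z u = weight z v.
Proof. by move=> uv; rewrite /weight (perm_big _ uv). Qed.

Lemma weight_rev w : weight z (rev w) = weight z w.
Proof. by apply: perm_weight; rewrite perm_rev. Qed.

Lemma weight_rcons w x : weight z (rcons w x) = (excess x).+1 + weight z w.
Proof. by rewrite -weight_rev rev_rcons weight_cons weight_rev. Qed.

Lemma perm_total_excess u v : perm_eq u v -> total_excess u = total_excess v.
Proof. by move=> uv; rewrite /total_excess (perm_big _ uv). Qed.

Lemma total_excess_cons x w : total_excess (x :: w) = excess x + total_excess w.
Proof. by rewrite /total_excess big_cons. Qed.

(** A letter [b_i] has excess [z i] and [a] has excess 0. Hence the total excess equals n·z
    throughout [Gamma], which is where the bound on [p] comes from. *)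
Lemma total_excess_count w :
  total_excess w = dotn (fun i => count_mem (letter_b i) w) z.
Proof.
rewrite /dotn; elim: w => [|x w IHw].
  by rewrite /total_excess big_nil big1.
rewrite total_excess_cons IHw.
under [RHS]eq_bigr => i _ do rewrite /= mulnDl.
rewrite big_split /=; congr (_ + _).
case: x => [i|]; last by rewrite big1.
rewrite (bigD1 i) //= eqxx mul1n big1 ?addn0 => [|j ji].
  by rewrite /excess /= addn1.
by rewrite /letter_b (inj_eq Some_inj) eq_sym (negPf ji).
Qed.

(** * Moving the cut of a pair *)

Definition glue (s : word m * word m) : word m := s.1 ++ s.2.

Definition mirror (s : word m * word m) : word m * word m := (rev s.2, rev s.1).

Lemma mirrorK : involutive mirror.
Proof. by case=> u v; rewrite /mirror /= !revK. Qed.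

Lemma perm_glue_mirror s : perm_eq (glue (mirror s)) (glue s).
Proof. by rewrite /glue /mirror -rev_cat perm_rev. Qed.

(* The first argument is fuel: the length of the word is enough. *)
Fixpoint move_right (N : nat) (s : word m * word m) : word m * word m :=
  match N, s.2 with
  | N'.+1, x :: v =>
      let s' :=
        iter (excess x) (fun t => mirror (move_right N' (mirror t))) (s.1, v) in
      (rcons s'.1 x, s'.2)
  | _, _ => s
  end.

(** The body of [move_right] contains this map unfolded, so that one structural recursion serves
    both directions. *)
Definition move_left N s := mirror (move_right N (mirror s)).

Lemma move_right_cons N u x v (s := iter (excess x) (move_left N) (u, v)) :
  move_right N.+1 (u, x :: v) = (rcons s.1 x, s.2).
Proof. by []. Qed.

Lemma iter_move_left_mirror N j s :
  iter j (move_left N) (mirror s) = mirror (iter j (move_right N) s).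
Proof. by elim: j => //= j ->; rewrite /move_left mirrorK. Qed.

Lemma move_left_rcons N u v x (s := iter (excess x) (move_right N) (u, v)) :
  move_left N.+1 (rcons u x, v) = (s.1, x :: s.2).
Proof.
rewrite {1}/move_left {2}/mirror rev_rcons move_right_cons -/(mirror (u, v)).
by rewrite iter_move_left_mirror /mirror /= rev_rcons !revK.
Qed.

(** The inequality is strict on the side that loses weight, so a right move turns this condition
    into [left_movable]. *)
Definition right_movable s :=
  (total_excess (glue s) <= weight z s.1) && (total_excess (glue s) < weight z s.2).

Definition left_movable s :=
  (total_excess (glue s) < weight z s.1) && (total_excess (glue s) <= weight z s.2).

Lemma right_movable_mirror s : right_movable (mirror s) = left_movable s.
Proof.
rewrite /right_movable (perm_total_excess _ _ (perm_glue_mirror s)).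
by rewrite !weight_rev andbC.
Qed.

Definition right_move_spec N s (s' := move_right N s) :=
  [/\ perm_eq (glue s') (glue s), weight z s'.1 = (weight z s.1).+1,
      (weight z s'.2).+1 = weight z s.2 & move_left N s' = s].

Definition left_move_spec N s (s' := move_left N s) :=
  [/\ perm_eq (glue s') (glue s), (weight z s'.1).+1 = weight z s.1,
      weight z s'.2 = (weight z s.2).+1 & move_right N s' = s].

Lemma left_move_mirror N s : right_move_spec N (mirror s) -> left_move_spec N s.
Proof.
case; rewrite /left_move_spec /move_left /= !weight_rev => permN w1 w2 sK; split=> //.
  by rewrite (permPl (perm_glue_mirror _)) (permPl permN) perm_glue_mirror.
exact: (can_inj mirrorK) sK.
Qed.

(** Each step costs one unit on the left, so the slack [j] keeps the pair left movable before every
    step. *)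
Lemma iter_move_left N s j (s' := iter j (move_left N) s) :
  (forall t, size (glue t) <= N -> left_movable t -> left_move_spec N t) ->
  size (glue s) <= N -> total_excess (glue s) + j <= weight z s.1 ->
  total_excess (glue s) <= weight z s.2 ->
  [/\ perm_eq (glue s') (glue s), weight z s'.1 + j = weight z s.1,
      weight z s'.2 = weight z s.2 + j & iter j (move_right N) s' = s].
Proof.
move=> moveN szs le1 le2; rewrite {}/s'; elim: j le1 => [|j IHj] le1.
  by rewrite !addn0; split.
have [|permj w1 w2 jK] := IHj; first lia.
rewrite [iter j.+1 (move_left N) s]iterS.
move: (iter j _ s) permj w1 w2 jK => t permj w1 w2 jK.
have [||permt wt1 wt2 tK] := moveN t.
- by rewrite (perm_size permj).
- by rewrite /left_movable (perm_total_excess _ _ permj); lia.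
(* The last left move is undone first. *)
rewrite iterSr tK (permPl permt); split=> //; lia.
Qed.

Lemma move_rightP N s :
  size (glue s) <= N -> right_movable s -> right_move_spec N s.
Proof.
elim: N s => [|N IHN] [u [|x v]] szs /andP[]; rewrite /= ?[weight z [::]]big_nil //.
  by move: szs; rewrite /glue size_cat addnS.
have perm_uxv : perm_eq (u ++ x :: v) (x :: u ++ v).
  by rewrite -cat1s perm_catCA.
rewrite (perm_total_excess _ _ perm_uxv) total_excess_cons weight_cons => le1 le2.
have moveN t : size (glue t) <= N -> left_movable t -> left_move_spec N t.
  move=> szt; rewrite -right_movable_mirror => movt; apply: left_move_mirror.
  by apply: IHN movt; rewrite (perm_size (perm_glue_mirror t)).
(* Without [x] the total excess is smaller by [excess x], which is exactly the slack needed for that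
   many left moves. *)
have [|||] := iter_move_left N (u, v) (excess x) moveN.
- by move: szs; rewrite /glue !size_cat /=; lia.
- rewrite /glue /=; lia.
- rewrite /glue /=; lia.
rewrite /right_move_spec move_right_cons.
case: (iter _ _ (u, v)) => u' v' /= perm' w1 w2 sK; split.
- by rewrite /glue /= (permPr perm_uxv) cat_rcons -cat1s perm_catCA perm_cons.
- by rewrite weight_rcons; lia.
- by rewrite weight_cons; lia.
(* The left move takes out the very letter [x] just inserted, so only the iterated moves have to
   cancel. *)
- by rewrite move_left_rcons sK.
Qed.

Lemma move_leftP N s :
  size (glue s) <= N -> left_movable s -> left_move_spec N s.
Proof.
rewrite -right_movable_mirror -(perm_size (perm_glue_mirror s)) => szs movs.
exact: left_move_mirror (move_rightP _ _ szs movs).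
Qed.

(** * From pairs back to words *)

Fixpoint cut (r : nat) (w : word m) : word m * word m :=
  if w is x :: w' then
    if r is 0 then ([::], w)
    else let s := cut (r - lweight z x) w' in (x :: s.1, s.2)
  else ([::], [::]).

(** Letters have positive weight, so a word has at most one prefix of a given weight. *)
Lemma glueK s : cut (weight z s.1) (glue s) = s.
Proof.
case: s => u v; rewrite /glue /=; elim: u => [|x u IHu] /=.
  by rewrite /weight big_nil; case: v.
by rewrite weight_cons addSn lweightE -addSn addKn IHu.
Qed.

Definition shift_right r w := glue (move_right (size w) (cut r w)).

Definition shift_left r w := glue (move_left (size w) (cut r w)).

Lemma shift_rightP r w s : w = glue s -> weight z s.1 = r -> right_movable s ->
  [/\ perm_eq (shift_right r w) w,
      exists2 t, shift_right r w = glue t & weight z t.1 = r.+1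
    & shift_left r.+1 (shift_right r w) = w].
Proof.
move=> -> <- movs; rewrite /shift_right glueK.
have [perms w1 w2 sK] := move_rightP _ _ (leqnn _) movs.
split=> //; first by exists (move_right (size (glue s)) s).
(* Permuted words have equal size, so both moves run with the same fuel. *)
by rewrite /shift_left -w1 glueK (perm_size perms) sK.
Qed.

Lemma shift_leftP r w s : w = glue s -> weight z s.1 = r.+1 -> left_movable s ->
  [/\ perm_eq (shift_left r.+1 w) w,
      exists2 t, shift_left r.+1 w = glue t & weight z t.1 = r
    & shift_right r (shift_left r.+1 w) = w].
Proof.
move=> -> ws movs; rewrite /shift_left -ws glueK.
have [perms w1 w2 sK] := move_leftP _ _ (leqnn _) movs.
have wr : weight z (move_left (size (glue s)) s).1 = r by lia.
split=> //; first by exists (move_left (size (glue s)) s).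
by rewrite /shift_right -{1}wr glueK (perm_size perms) sK.
Qed.

Lemma Gamma_prefixP P k (r : nat) w :
  reflect (Gamma z P k w /\ exists2 s, w = glue s & weight z s.1 = r)
          (Gamma_prefix z P k r w).
Proof.
apply: (iffP andP) => -[Gw]; split=> //.
  case/existsP: b => j /eqP[wj].
  by exists (take j w, drop j w); rewrite // /glue cat_take_drop.
case: b => -[u v] -> /= wu; apply/existsP.
have lt_u : size u < (size (glue (u, v))).+1 by rewrite size_cat ltnS leq_addr.
by exists (Ordinal lt_u); rewrite /= /glue take_size_cat // wu.
Qed.

Lemma perm_Gamma P k w w' : perm_eq w w' -> Gamma z P k w = Gamma z P k w'.
Proof.
move=> ww'; rewrite /Gamma (perm_weight _ _ ww'); congr (_ && _).
by apply: eq_forallb => i; rewrite (permP ww').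
Qed.

Lemma Gamma_total_excess P k w : Gamma z P k w -> total_excess w = dotn k z.
Proof.
case/andP=> _ /forallP kw; rewrite total_excess_count.
by apply: eq_bigr => i _; rewrite (eqP (kw i)).
Qed.

Lemma Gamma_weight P k w : Gamma z P k w -> Posz (weight z w) = P.
Proof. by case/andP=> /eqP. Qed.

End Cut.

Lemma sig_bijective {T : Type} (P Q : pred T) (f g : T -> T) :
  (forall x, P x -> Q (f x) /\ g (f x) = x) ->
  (forall y, Q y -> P (g y) /\ f (g y) = y) ->
  exists h : {x | P x} -> {y | Q y}, bijective h.
Proof.
move=> fP gP.
exists (fun x => exist Q (f (val x)) (proj1 (fP _ (valP x)))).
exists (fun y => exist P (g (val y)) (proj1 (gP _ (valP y)))) => x; apply: val_inj.
  exact: (fP _ (valP x)).2.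
exact: (gP _ (valP x)).2.
Qed.

Theorem theorem2p2 (m : nat) (hm : (1 <= m)%N) (z n : 'I_m -> nat) (p q : int)
    (hp : (dotn n z)%:Z <= p) (hq : 1 <= q) :
  exists f : {w : word m | Gamma_prefix z (p + q + (dotn n z)%:Z) n p w} ->
             {w : word m | Gamma_prefix z (p + q + (dotn n z)%:Z) n (p + 1) w},
    bijective f.
Proof.
case: p hp => // p hp.
case: q hq => // q hq.
have -> : p%:Z + 1 = p.+1%:Z by lia.
apply: (sig_bijective _ _ (shift_right m z p) (shift_left m z p.+1)) => w.
  case/Gamma_prefixP=> Gw [s ws w1].
  have ww := Gamma_weight _ _ _ _ _ Gw; have ew := Gamma_total_excess _ _ _ _ _ Gw.
  (* The parts weigh [p] and q + n·z, and the second exceeds n·z because q ≥ 1. *)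
  have movs : right_movable m z s.
    move: ww; rewrite /right_movable -ws ew ws weight_cat; lia.
  have [permw cutw wK] := shift_rightP _ _ _ _ _ ws w1 movs.
  by split=> //; apply/Gamma_prefixP; rewrite (perm_Gamma _ _ _ _ _ _ permw).
case/Gamma_prefixP=> Gw [s ws w1].
have ww := Gamma_weight _ _ _ _ _ Gw; have ew := Gamma_total_excess _ _ _ _ _ Gw.
(* Here the parts weigh p + 1 and q - 1 + n·z. *)
have movs : left_movable m z s.
  move: ww; rewrite /left_movable -ws ew ws weight_cat; lia.
have [permw cutw wK] := shift_leftP _ _ _ _ _ ws w1 movs.
by split=> //; apply/Gamma_prefixP; rewrite (perm_Gamma _ _ _ _ _ _ permw).
Qed.
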